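(* Consider $w\in\mathfrak{S}_n$, with the Bruhat order on $\mathfrak{S}_n$, and let $T$ be the support of $w$. Then $[\sigma,w]$ is boolean (equivalently, a modular lattice, or a distributive lattice) for all $\sigma\in T$ if and only if $w$ is a product of distinct generators (meaning that the principal order ideal of $w$ in the Bruhat order is also boolean), or $w=\sigma_{k+1}\sigma_k\sigma_{k+1}$ for some $k$.
   Context: $\mathfrak{S}_n$ is the symmetric group with Coxeter generators $\sigma_1,\dots,\sigma_{n-1}$, where $\sigma_i$ is the transposition swapping $i$ and $i+1$. A reduced decomposition of $w$ is a word of minimal length in these generators with product $w$. The support of $w$ is the set of generators appearing in reduced decompositions of $w$. Bruhat order: $v\le w$ if some reduced decomposition of $v$ is a (not necessarily contiguous) subword of a reduced decomposition of $w$. $[v,w]=\{u: v\le u\le w\}$ for $v\le w$, and the principal order ideal of $w$ is $\{u: u\le w\}$. A poset is boolean if it is isomorphic to the poset of all subsets of a finite set, ordered by inclusion. The identity counts as the empty product of distinct generators. *)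

(* Defs.v *)
From HB Require Import structures.
From mathcomp Require Import all_boot all_order all_fingroup.

Set Implicit Arguments.
Unset Strict Implicit.
Unset Printing Implicit Defensive.

Local Open Scope group_scope.

(* Permutations act on {0, ..., n-1}, so the generators are indexed from 0:
   [gen i] swaps i and i+1.  Products of permutations compose from left to
   right; composing from right to left instead replaces each permutation by its
   inverse and each word by its reversal, so nothing below depends on it. *)
Lemma gen_succ_proof (n : nat) (i : 'I_n.-1) : i.+1 < n.
Proof. by rewrite -ltn_predRL. Qed.

Definition gen (n : nat) (i : 'I_n.-1) : 'S_n :=
  tperm (widen_ord (leq_pred n) i) (Ordinal (gen_succ_proof i)).

Definition word_prod (n : nat) (s : seq 'I_n.-1) : 'S_n :=
  \prod_(i <- s) gen i.

Definition reduced_decomposition (n : nat) (w : 'S_n) (s : seq 'I_n.-1) : Prop :=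
  word_prod s = w /\
  forall t : seq 'I_n.-1, word_prod t = w -> size s <= size t.

Definition in_support (n : nat) (w x : 'S_n) : Prop :=
  exists (s : seq 'I_n.-1) (i : 'I_n.-1),
    [/\ reduced_decomposition w s, i \in s & x = gen i].

Definition bruhat (n : nat) (v w : 'S_n) : Prop :=
  exists s t : seq 'I_n.-1,
    [/\ reduced_decomposition v s, reduced_decomposition w t & subseq s t].

Definition interval (n : nat) (v w : 'S_n) : 'S_n -> Prop :=
  fun u => bruhat v u /\ bruhat u w.

Definition principal_ideal (n : nat) (w : 'S_n) : 'S_n -> Prop :=
  fun u => bruhat u w.

Definition distinct_generators_product (n : nat) (w : 'S_n) : Prop :=
  exists s : seq 'I_n.-1, uniq s /\ word_prod s = w.

(* (A, leT), with leT restricted to the subset A of T, is isomorphic to (U, leU). *)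
Definition order_isomorphic (T : Type) (A : T -> Prop) (leT : T -> T -> Prop)
    (U : Type) (leU : rel U) : Prop :=
  exists f : T -> U,
    [/\ forall x y : T, A x -> A y -> f x = f y -> x = y,
        forall z : U, exists x : T, A x /\ f x = z
      & forall x y : T, A x -> A y -> (leT x y <-> leU (f x) (f y))].

Definition is_boolean (T : Type) (A : T -> Prop) (leT : T -> T -> Prop) : Prop :=
  exists X : finType,
    order_isomorphic A leT (fun B C : {set X} => B \subset C).

Definition is_modular_lattice (T : Type) (A : T -> Prop)
    (leT : T -> T -> Prop) : Prop :=
  exists (d : Order.disp_t) (L : latticeType d),
    order_isomorphic A leT (@Order.le d L) /\
    forall a b c : L, (a <= c)%O -> (a `|` (b `&` c) = (a `|` b) `&` c)%O.

Definition is_distributive_lattice (T : Type) (A : T -> Prop)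
    (leT : T -> T -> Prop) : Prop :=
  exists (d : Order.disp_t) (L : distrLatticeType d),
    order_isomorphic A leT (@Order.le d L).

(* Main.v *)
Require Import Defs.
From HB Require Import structures.
From mathcomp Require Import all_boot all_order all_fingroup.
From mathcomp Require Import zify.

(* The Bruhat order is the pointwise order of the rank matrices
   #{a < p | w a >= q}.  Multiplication by a simple transposition changes a
   single row, which a descent makes as large, and an ascent as small, as the
   neighbouring rows allow; the lifting property, and from it the subword
   property, gradedness and thinness (every interval of rank 2 has exactly two
   interior elements), follow.

   A graded thin modular lattice is boolean: thinness makes it atomistic, and
   the covering law makes an atom below a join of atoms one of them, since
   otherwise the join of two atoms would dominate a third.

   If [gen i, w] is boolean it has len w - 1 atoms, which are the products
   gen i * gen t and gen t * gen i below w, with t in the support.  For i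
   minimal in the support, only t = i + 1 can contribute two of them, so
   len w <= p + 1 with p the size of the support.  If len w = p + 1, a reduced
   word of w repeats exactly one letter a, and every i has a neighbour t such
   that gen i * gen t and gen t * gen i are distinct and below w.  One of i, t
   must then be a, so every other letter is adjacent to a; two of them would
   give 4 > p = 3 atoms above gen a, hence p = 2. *)

Set Implicit Arguments.
Unset Strict Implicit.
Unset Printing Implicit Defensive.

(** * Thin modular lattices *)

Section RankedModularLattice.
Import Order.Theory.
Local Open Scope order_scope.

Variables (disp : Order.disp_t) (L : latticeType disp) (rank : L -> nat) (o : L).
Implicit Types (a b c e p q : L).

Hypothesis le_o : forall a, o <= a.
Hypothesis lt_rank : forall a b, a < b -> (rank a < rank b)%N.
Hypothesis chain : forall a b, a < b -> exists c, [/\ a <= c, c < b & rank b = (rank c).+1].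
Hypothesis thin : forall a b, a < b -> rank b = (rank a).+2 ->
  exists y1 y2, y1 != y2 /\ forall z, (a < z < b) = (z == y1) || (z == y2).

Definition atom p := rank p == (rank o).+1.

Lemma le_rank_eq a b : a <= b -> (rank b <= rank a)%N -> a = b.
Proof.
move=> h r; apply/eqP; move: h; rewrite le_eqVlt => /orP [//|/lt_rank].
by rewrite ltnNge r.
Qed.

(** Induction on the rank: above rank 1, [c] is the join of the two elements that thinness places
    between [c] and an element two ranks lower. *)
Lemma atomistic c e : (forall p, atom p -> p <= c -> p <= e) -> c <= e.
Proof.
have [m] := ubnP (rank c); elim: m c => // m IH c lm h.
have [<-|co] := eqVneq o c; first exact: le_o.
have [//|na] := boolP (atom c); first by move/h; apply.
have oc : o < c by rewrite lt_neqAle co le_o.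
have [c1 [_ c1c r1]] := chain oc.
have oc1 : o < c1.
  rewrite lt_neqAle le_o andbT; apply: contra na => /eqP E.
  by rewrite /atom E r1.
have [c2 [_ c21 r2]] := chain oc1.
have [||y1 [y2 [ne E]]] := @thin c2 c; [exact: lt_trans c1c|by rewrite r1 r2|].
have b1 : c2 < y1 < c by rewrite E eqxx.
have b2 : c2 < y2 < c by rewrite E eqxx orbT.
have low y : c2 < y < c -> y <= e /\ rank y = (rank c2).+1.
  case/andP => /lt_rank r3 yc; have r4 := lt_rank yc; split; last first.
    by move: r1 r2 r3 r4; clear; lia.
  by apply: IH => [|p pa py]; [exact: leq_trans r4 lm|apply: h => //; apply: le_trans py (ltW yc)].
have [[l1 s1] [l2 s2]] := (low _ b1, low _ b2).
suff <- : y1 `|` y2 = c by rewrite leUx l1 l2.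
have [/andP [_ m1] /andP [_ m2]] := (b1, b2).
apply: le_rank_eq; first by rewrite leUx !ltW.
rewrite leqNgt r1 r2 -s1 ltnS; apply/negP => lr; case/eqP: ne.
rewrite (le_rank_eq (leUl y1 y2) lr); apply/esym/le_rank_eq; first exact: leUr.
by rewrite s2 -s1.
Qed.

Hypothesis modular : forall a b c, a <= c -> a `|` (b `&` c) = (a `|` b) `&` c.

(** Let [c] be covered by the join and lie above [b]. Its meet with [a] is either the meet of [a]
    and [b], and then [c = b] by modularity, or [a] itself, and then [c] dominates the join. *)
Lemma join_cover a b : rank a = (rank (a `&` b)).+1 -> rank (a `|` b) = (rank b).+1.
Proof.
move=> r; have lt : b < a `|` b.
  rewrite lt_neqAle leUr andbT; apply/eqP => E.
  by move: r; rewrite E joinKI; lia.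
have [c [bc cab ->]] := chain lt; congr (rank _).+1.
have [E|E] := eqVneq (a `&` c) (a `&` b).
  have : c = b `|` (a `&` c) by rewrite modular // joinC meetC; apply/esym/meet_l/ltW.
  by rewrite E (join_l (leIr _ _)).
have ac : a `&` c = a.
  have l : a `&` b < a `&` c by rewrite lt_neqAle eq_sym E leI2.
  by apply: le_rank_eq (leIl _ _) _; have := lt_rank l; lia.
have : a `|` b <= c by rewrite leUx bc andbT -ac leIr.
by move=> h; have := le_lt_trans h cab; rewrite ltxx.
Qed.

Lemma meet_cover a b : rank (a `|` b) = (rank b).+1 -> rank a = (rank (a `&` b)).+1.
Proof.
move=> r; have lt : a `&` b < a.
  rewrite lt_neqAle leIl andbT; apply/eqP => E.
  by have /meet_idPl ab := E; move: r; rewrite (join_r ab); lia.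
have [c [abc ca ->]] := chain lt; congr (rank _).+1.
have [E|E] := eqVneq (c `|` b) b.
  by apply: le_anti; rewrite abc lexI (ltW ca) -E leUl.
have cb : c `|` b = a `|` b.
  have l : b < c `|` b by rewrite lt_neqAle eq_sym E leUr.
  apply: le_rank_eq; first by rewrite leU2 // ltW.
  by have := lt_rank l; lia.
have := @modular c b a (ltW ca); rewrite cb [b `&` a]meetC (join_l abc).
by rewrite (meet_r (leUl _ _)) => E'; move: ca; rewrite E' ltxx.
Qed.

Lemma atom_independent (s : seq L) p : all atom s -> atom p ->
  p <= foldr Order.join o s -> p \in s.
Proof.
elim: s p => [|q s IH] p /=.
  move=> _ /eqP r h; have E : o = p by apply: le_anti; rewrite h le_o.
  by move: r; rewrite E; lia.
set c := foldr _ _ s => /andP [qa sa] pa pc; rewrite inE.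
apply: contraT; rewrite negb_or => /andP [pq ps].
have npc : ~~ (p <= c) by apply: contra ps; apply: IH.
have nqc : ~~ (q <= c) by apply: contra npc => h; move: pc; rewrite (join_r h).
have minimal x y : atom x -> ~~ (x <= y) -> x `&` y = o.
  move=> /eqP xa nxy; apply/esym/le_rank_eq; first exact: le_o.
  have l : x `&` y < x.
    by rewrite lt_neqAle leIl andbT; apply: contra nxy => /eqP <-; rewrite leIr.
  by have := lt_rank l; lia.
have npq : ~~ (q <= p).
  apply: contra pq => h; rewrite eq_sym; apply/eqP/le_rank_eq => //.
  by rewrite (eqP pa) (eqP qa).
have r1 : rank (q `|` c) = (rank c).+1 by apply: join_cover; rewrite minimal // (eqP qa).
have r2 : rank (q `|` p) = (rank p).+1 by apply: join_cover; rewrite minimal // (eqP qa).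
have E : (q `|` p) `|` c = q `|` c.
  by apply: le_anti; rewrite !leUx pc leUl leUr /= -joinA leUl joinA leUr.
have r3 : rank (q `|` p) = (rank ((q `|` p) `&` c)).+1.
  by apply: meet_cover; rewrite E r1.
(* [r] has the rank of [p], so it is a third atom below the join of [p] and [q]; it differs from
   both because it lies below [c]. This contradicts thinness. *)
set r := _ `&` c in r3.
have ro : o < q `|` p.
  by rewrite lt_neqAle le_o andbT; apply/eqP => e; move: r2; rewrite -e (eqP pa); clear; lia.
have [|y1 [y2 [_ T]]] := thin ro; first by rewrite r2 (eqP pa).
have bet x : rank x = rank p -> x <= q `|` p -> (x == y1) || (x == y2).
  move=> rx l; rewrite -T !lt_neqAle le_o l !andbT; apply/andP; split.
    by apply/eqP => e; move: rx; rewrite -e (eqP pa); clear; lia.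
  by apply/eqP => e; move: rx; rewrite e r2; clear; lia.
have bp := bet p erefl (leUr _ _).
have bq : (q == y1) || (q == y2) by apply: bet; rewrite ?leUl // (eqP pa) (eqP qa).
have br : (r == y1) || (r == y2) by apply: bet; rewrite ?leIl //; move: r3; rewrite r2 => -[].
have rp : r != p by apply: contra npc => /eqP <-; rewrite leIr.
have rq : r != q by apply: contra nqc => /eqP <-; rewrite leIr.
move: bp bq br pq rp rq.
by do 3![case/orP => /eqP ->]; rewrite ?eqxx.
Qed.

Lemma join_atoms (s : seq L) p : all atom s -> atom p ->
  (p <= foldr Order.join o s) = (p \in s).
Proof.
move=> sa pa; apply/idP/idP; first exact: atom_independent.
elim: s {sa} => //= q s IH; rewrite inE => /predU1P [->|/IH h]; first exact: leUl.
exact: le_trans h (leUr _ _).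
Qed.

End RankedModularLattice.

Local Open Scope group_scope.

(** * Descents and reduced words *)

Section Generators.
Variable n : nat.
Implicit Types (u v w : 'S_n) (i j : 'I_n.-1) (a b : 'I_n).

Definition lo i : 'I_n := widen_ord (leq_pred n) i.
Definition hi i : 'I_n := Ordinal (gen_succ_proof i).

Lemma gen_lo i : gen i (lo i) = hi i. Proof. exact: tpermL. Qed.
Lemma gen_hi i : gen i (hi i) = lo i. Proof. exact: tpermR. Qed.

Lemma genK i : involutive (gen i). Proof. exact: tpermK. Qed.

Lemma gen_mulK i u : gen i * (gen i * u) = u.
Proof. by rewrite mulgA tperm2 mul1g. Qed.

(** Indexed by the image both as an ordinal and as a number, so that one case analysis rewrites
    either reading. *)
Variant gen_spec i a : 'I_n -> nat -> Type :=
  | GenLo of a = lo i & nat_of_ord a = i : gen_spec i a (hi i) i.+1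
  | GenHi of a = hi i & nat_of_ord a = i.+1 : gen_spec i a (lo i) i
  | GenD of nat_of_ord a <> i & nat_of_ord a <> i.+1 : gen_spec i a a a.

Lemma genP i a : gen_spec i a (gen i a) (gen i a).
Proof.
rewrite /gen; case: tpermP => [->|->|h1 h2]; try by constructor.
by constructor => E; [apply: h1|apply: h2]; apply: val_inj.
Qed.

Lemma gen_ltn i a p : p != i.+1 -> (gen i a < p) = (a < p).
Proof. by move=> /eqP; case: (genP i a); lia. Qed.

Ltac gen_cases :=
  repeat match goal with |- context [fun_of_perm (gen ?k) ?b] =>
    lazymatch b with context [gen _] => fail | _ => idtac end;
    case: (genP k b) => /= *; try lia
  end.

Lemma gen_comm i j : (i.+1 < j) || (j.+1 < i) -> gen i * gen j = gen j * gen i.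
Proof.
by move=> h; apply/permP => a; rewrite !permM; apply: val_inj => /=; gen_cases.
Qed.

Lemma gen_braid i j : nat_of_ord j = i.+1 ->
  gen j * gen i * gen j = gen i * gen j * gen i.
Proof.
by move=> h; apply/permP => a; rewrite !permM; apply: val_inj => /=; gen_cases.
Qed.

Lemma word_prod_cons i s : word_prod (i :: s) = gen i * word_prod s.
Proof. by rewrite /word_prod big_cons. Qed.

Lemma word_prod_nil : word_prod [::] = 1 :> 'S_n.
Proof. by rewrite /word_prod big_nil. Qed.

(** Left multiplication by [gen i] permutes positions, so this is a descent of the one-line
    notation. *)
Definition desc i u := u (hi i) < u (lo i).

Lemma descN i u : desc i (gen i * u) = ~~ desc i u.
Proof.
rewrite /desc !permM gen_lo gen_hi -leqNgt ltn_neqAle.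
have -> //: (u (lo i) != u (hi i) :> nat).
by apply/eqP => /val_inj/perm_inj/(congr1 val) /=; lia.
Qed.

Lemma asc_gen2 i j : nat_of_ord j = i.+1 -> ~~ desc j (gen i * gen j).
Proof. by move=> h; rewrite /desc -leqNgt !permM; gen_cases. Qed.

Definition inversions u := [set c : 'I_n * 'I_n | (c.1 < c.2) && (u c.2 < u c.1)].
Definition len u := #|inversions u|.

(** Relabelling positions by [gen i] matches the inversions of [u] other than [(lo i, hi i)] with
    those of [gen i * u]. *)
Lemma len_desc i u : desc i u -> len u = (len (gen i * u)).+1.
Proof.
rewrite /desc => d; rewrite /len (cardsD1 (lo i, hi i)) inE /= ltnSn d /=.
congr _.+1; pose g (c : 'I_n * 'I_n) := (gen i c.1, gen i c.2).
have gK : involutive g by case=> a b; rewrite /g /= !genK.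
rewrite -(card_imset _ (inv_inj gK)); apply: eq_card => -[a b].
have -> : ((a, b) \in [set g x | x in inversions u :\ (lo i, hi i)]) =
          (g (a, b) \in inversions u :\ (lo i, hi i)).
  by rewrite -{1}[(a, b)]gK mem_imset //; exact: inv_inj.
rewrite !inE /g /= !permM xpair_eqE.
have E1 : (gen i a == lo i) = (a == hi i) by rewrite -{1}(gen_hi i) (inj_eq perm_inj).
have E2 : (gen i b == hi i) = (b == lo i) by rewrite -{1}(gen_lo i) (inj_eq perm_inj).
rewrite E1 E2.
have [[-> ->]|h] : (a = lo i /\ b = hi i) \/ ~ (a = lo i /\ b = hi i).
- by case: (a =P lo i) => [->|]; case: (b =P hi i) => [->|]; tauto.
- by rewrite gen_lo gen_hi /= ltnSn /=; lia.
have [[-> ->]|h'] : (a = hi i /\ b = lo i) \/ ~ (a = hi i /\ b = lo i).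
- by case: (a =P hi i) => [->|]; case: (b =P lo i) => [->|]; tauto.
- by rewrite !eqxx /=; lia.
have -> : ~~ ((a == hi i) && (b == lo i)) by apply/negP => /andP [/eqP ? /eqP ?]; apply: h'.
congr (_ && _).
case: (genP i a) => ha; case: (genP i b) => hb; subst; try by [lia|exfalso; tauto].
Qed.

Lemma len_asc i u : ~~ desc i u -> len (gen i * u) = (len u).+1.
Proof. by move=> d; rewrite (@len_desc i) ?descN // gen_mulK. Qed.

(** Without descents [u] is increasing, so [u a >= a] for all [a]; both sides have the same sum,
    hence agree term by term. *)
Lemma exists_desc u : u != 1 -> exists i, desc i u.
Proof.
move=> u1; apply/existsP; apply: contraR u1 => /existsPn nd.
have step (a b : 'I_n) : b = a.+1 :> nat -> u a < u b.
  move=> E; have li : a < n.-1 by have := ltn_ord b; lia.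
  have := nd (Ordinal li); rewrite /desc -leqNgt leq_eqVlt => /orP [/eqP|].
    by move/val_inj/perm_inj/(congr1 val) => /=; lia.
  by have [-> ->] : lo (Ordinal li) = a /\ hi (Ordinal li) = b by split; apply: val_inj.
have ge m : forall a : 'I_n, a = m :> nat -> m <= u a.
  elim: m => [//|m IH] a E; have lm : m < n by have := ltn_ord a; lia.
  have := step (Ordinal lm) a; have := IH (Ordinal lm) erefl; move: E => /= -> h /(_ erefl); lia.
have := @leqif_sum _ predT (fun a : 'I_n => a == u a :> nat) (fun a => a) (fun a => u a).
case=> [a _|_]; first exact/leqif_eq/ge.
rewrite (reindex_inj (@perm_inj _ u)) /= eqxx => /esym/forallP h.
by apply/eqP/permP => a; rewrite perm1; apply: val_inj; move: (h a) => /= /eqP.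
Qed.

Lemma len1 : len 1 = 0.
Proof. by apply: eq_card0 => -[a b]; rewrite !inE !perm1 /=; lia. Qed.

(** Removing a descent shortens, so every permutation is built from [1] by ascents only. *)
Lemma desc_ind (P : 'S_n -> Prop) : P 1 ->
  (forall i u, ~~ desc i u -> P u -> P (gen i * u)) -> forall u, P u.
Proof.
move=> P1 PS u; have [m] := ubnP (len u); elim: m u => // m IH u lu.
have [->//|/exists_desc [i d]] := eqVneq u 1.
rewrite -(gen_mulK i u); apply: PS; first by rewrite descN negbK.
by apply: IH; move: lu; rewrite (len_desc d).
Qed.

(** A local test: read from the right, every letter must be an ascent. [reduced_decompositionP]
    identifies it with minimality of the size. *)
Fixpoint reducedb (s : seq 'I_n.-1) :=
  if s is i :: t then reducedb t && ~~ desc i (word_prod t) else true.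

Lemma len_word_prod s : len (word_prod s) <= size s ?= iff reducedb s.
Proof.
elim: s => [|i s IH] /=; first by rewrite word_prod_nil len1; apply/leqif_refl.
rewrite word_prod_cons; have := IH; case: (boolP (desc i (word_prod s))) => d.
  rewrite andbF (len_desc d) => -[h _]; split; first by lia.
  by apply/negbTE; lia.
by rewrite (len_asc d) andbT => -[h e]; split; rewrite ?eqSS.
Qed.

Lemma reducedb_size s : reducedb s -> size s = len (word_prod s).
Proof. by move=> h; apply/esym/eqP; rewrite (len_word_prod s). Qed.

Lemma exists_reducedb u : exists2 s, reducedb s & word_prod s = u.
Proof.
elim/desc_ind: u => [|i u d [s rs E]]; first by exists [::]; rewrite ?word_prod_nil.
by exists (i :: s); rewrite ?word_prod_cons /= ?E ?rs.
Qed.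

Lemma reduced_decompositionP u s :
  reduced_decomposition u s <-> reducedb s /\ word_prod s = u.
Proof.
split=> [[E min]|[r E]]; split=> //.
  have [t rt Et] := exists_reducedb u; have := min t Et.
  rewrite (reducedb_size rt) Et -E -(len_word_prod s).
  by have [] := len_word_prod s; lia.
by move=> t Et; rewrite (reducedb_size r) E -Et; have [] := len_word_prod t.
Qed.

End Generators.

(** * The Bruhat order *)

Section BruhatOrder.
Variable n : nat.
Implicit Types (u v w z : 'S_n) (i j : 'I_n.-1) (a b : 'I_n) (p q : nat).

Definition rk u p q := \sum_(a < n | a < p) (q <= u a : nat).

(** Columns from [n] on vanish and rows from [n] on are constant, so this bounded comparison decides
    the full one ([brleP]). *)
Definition brle u w := [forall p : 'I_n.+1, forall q : 'I_n.+1, rk u p q <= rk w p q].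

Lemma rkS u a q : rk u a.+1 q = rk u a q + (q <= u a).
Proof.
rewrite /rk (bigD1 a) //= addnC; congr (_ + _).
by apply: eq_bigl => b; rewrite -val_eqE /=; lia.
Qed.

Lemma rk_gen i u p q : p != i.+1 -> rk (gen i * u) p q = rk u p q.
Proof.
move=> h; rewrite /rk (reindex_inj (@perm_inj _ (gen i))) /=.
by apply: eq_big => [a|a _]; rewrite ?gen_ltn // permM genK.
Qed.

Lemma brleP u w : reflect (forall p q, rk u p q <= rk w p q) (brle u w).
Proof.
apply: (iffP forallP) => [h p q|h p]; last by apply/forallP => q.
have [lq|lq] := leqP n q.
  by rewrite {1}/rk big1 // => a _; have := ltn_ord (u a); lia.
have lp : minn p n < n.+1 by lia.
have lq' : q < n.+1 by lia.
have E z : rk z p q = rk z (minn p n) q.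
  by apply: eq_bigl => a; have := ltn_ord a; lia.
by rewrite !E; have /forallP/(_ (Ordinal lq')) := h (Ordinal lp).
Qed.

Lemma brle_refl u : brle u u.
Proof. exact/brleP. Qed.

Lemma brle_trans v u w : brle u v -> brle v w -> brle u w.
Proof.
by move=> /brleP h /brleP h'; apply/brleP => p q; apply: leq_trans (h p q) (h' p q).
Qed.

(** Differences of consecutive rows recover the truth of [q <= u a] for every [q], hence [u a]. *)
Lemma brle_anti u w : brle u w -> brle w u -> u = w.
Proof.
move=> /brleP h /brleP h'.
have E p q : rk u p q = rk w p q by have := h p q; have := h' p q; lia.
apply/permP => a; apply: val_inj; apply/eqP; rewrite eqn_leq.
have F q : (q <= u a) = (q <= w a).
  by have := rkS u a q; rewrite !E rkS; lia.
by rewrite -F leqnn F leqnn.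
Qed.

(* Row [i.+1] of the rank matrix is the largest (resp. smallest) one allowed by
   its two neighbours exactly when [i] is a descent (resp. an ascent); this
   makes the lifting property of the Bruhat order a monotonicity statement. *)
Lemma rk_desc i u q : desc i u -> rk u i.+1 q = minn (rk u i q).+1 (rk u i.+2 q).
Proof.
rewrite /desc => d; have := rkS u (hi i) q; have := rkS u (lo i) q => /=; lia.
Qed.

Lemma rk_asc i u q : ~~ desc i u ->
  rk u i.+1 q = maxn (rk u i q) (rk u i.+2 q).-1.
Proof.
rewrite /desc => d; have := rkS u (hi i) q; have := rkS u (lo i) q => /=; lia.
Qed.

(** [up] and [down] choose the longer and the shorter of [u] and [gen i * u], whose rank matrices
    differ only in row [i.+1]. *)
Definition up i u := if desc i u then u else gen i * u.
Definition down i u := if desc i u then gen i * u else u.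

Lemma desc_up i u : desc i (up i u).
Proof. by rewrite /up; case: ifP => // d; rewrite descN d. Qed.

Lemma desc_down i u : ~~ desc i (down i u).
Proof. by rewrite /down; case: ifP => [d|->//]; rewrite descN d. Qed.

Lemma rk_up i u p q : p != i.+1 -> rk (up i u) p q = rk u p q.
Proof. by rewrite /up; case: ifP => // _; exact: rk_gen. Qed.

Lemma rk_down i u p q : p != i.+1 -> rk (down i u) p q = rk u p q.
Proof. by rewrite /down; case: ifP => // _; exact: rk_gen. Qed.

Lemma brle_up i u w : brle u w -> brle (up i u) (up i w).
Proof.
move=> /brleP h; apply/brleP => p q.
have [->|e] := eqVneq p i.+1; last by rewrite !rk_up.
rewrite !rk_desc ?desc_up // !rk_up; try lia.
by have := h i q; have := h i.+2 q; lia.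
Qed.

Lemma brle_down i u w : brle u w -> brle (down i u) (down i w).
Proof.
move=> /brleP h; apply/brleP => p q.
have [->|e] := eqVneq p i.+1; last by rewrite !rk_down.
rewrite !rk_asc ?desc_down // !rk_down; try lia.
by have := h i q; have := h i.+2 q; lia.
Qed.

Lemma brle_gen i u : ~~ desc i u -> brle u (gen i * u).
Proof.
move=> d; apply/brleP => p q.
have [->|e] := eqVneq p i.+1; last by rewrite rk_gen.
rewrite rk_asc // rk_desc ?descN // !rk_gen; try lia.
have := rkS u (hi i) q; have := rkS u (lo i) q; move: d; rewrite /desc /=; lia.
Qed.

Lemma brle_desc i u : desc i u -> brle (gen i * u) u.
Proof. by move=> d; rewrite -{2}(gen_mulK i u) brle_gen // descN d. Qed.

(** The lifting property, read off from the monotonicity of [up] and [down]; the next two lemmas are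
    the cases where [u] and [w] behave alike at [i]. *)
Lemma lift_asc i u w : brle u w -> ~~ desc i u -> desc i w ->
  brle u (gen i * w) /\ brle (gen i * u) w.
Proof.
move=> h d d'; have := brle_up i h; have := brle_down i h.
by rewrite /up /down d' (negbTE d).
Qed.

Lemma lift_desc i u w : brle u w -> desc i u -> desc i w ->
  brle (gen i * u) (gen i * w).
Proof. by move=> h d d'; have := brle_down i h; rewrite /down d d'. Qed.

Lemma lift_gen i u w : brle u w -> ~~ desc i u -> ~~ desc i w ->
  brle (gen i * u) (gen i * w).
Proof.
by move=> h d d'; have := brle_up i h; rewrite /up (negbTE d) (negbTE d').
Qed.

Lemma brle1 u : brle 1 u.
Proof.
elim/desc_ind: u => [|i u d h]; first exact: brle_refl.
exact: brle_trans h (brle_gen d).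
Qed.

(** A shared first letter is added on both sides by lifting; a skipped letter of [t] only moves the
    right side up. *)
Lemma brle_subseq s t : reducedb s -> reducedb t -> subseq s t ->
  brle (word_prod s) (word_prod t : 'S_n).
Proof.
elim: t s => [|i t IH] [|j s] //.
- by move=> *; apply: brle_refl.
- by move=> *; rewrite word_prod_nil; apply: brle1.
rewrite !word_prod_cons /= => rs rt; have /andP [rs' ds] := rs; have /andP [rt' dt] := rt.
case: eqP => [e | _] h; first by subst j; exact: lift_gen (IH s rs' rt' h) ds dt.
rewrite -word_prod_cons; apply: brle_trans (brle_gen dt); exact: IH.
Qed.

(** The first letter of [s] is a descent of [w]; lifting strips it from [w], and from [u] too when
    it is a descent there. *)
Lemma subword s w u : reducedb s -> word_prod s = w -> brle u w ->
  exists t, [/\ reducedb t, word_prod t = u & subseq t s].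
Proof.
elim: s w u => [|i s IH] w u /=.
  move=> _ <- h; exists [::]; split=> //; apply: brle_anti h.
  by rewrite word_prod_nil brle1.
move=> /andP [rs d] E h.
have dw : desc i w by rewrite -E word_prod_cons descN d.
have Es : word_prod s = gen i * w by rewrite -E word_prod_cons gen_mulK.
have [du|du] := boolP (desc i u).
  have [t [rt Et st]] := IH _ _ rs Es (lift_desc h du dw).
  exists (i :: t); rewrite word_prod_cons Et gen_mulK /= eqxx rt Et descN du.
  by split.
have [t [rt Et st]] := IH _ _ rs Es (lift_asc h du dw).1.
by exists t; split=> //; apply: subseq_trans st (subseq_cons _ _).
Qed.

Lemma bruhatP u w : bruhat u w <-> brle u w.
Proof.
split=> [[s [t [/reduced_decompositionP [rs <-] /reduced_decompositionP [rt <-]]]]|h].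
  exact: brle_subseq.
have [t rt Et] := exists_reducedb w; have [s [rs Es st]] := subword rt Et h.
by exists s, t; split=> //; apply/reduced_decompositionP.
Qed.

Lemma brle_len u w : brle u w -> len u <= len w ?= iff (u == w).
Proof.
move=> h; have [t rt Et] := exists_reducedb w; have [s [rs Es st]] := subword rt Et h.
rewrite -Et -Es -(reducedb_size rs) -(reducedb_size rt).
have := size_subseq_leqif st; congr (_ <= _ ?= iff _).
apply/eqP/eqP => [->//|E]; apply/eqP; rewrite -(size_subseq_leqif st).
by rewrite (reducedb_size rs) (reducedb_size rt) E.
Qed.

Lemma brlt_len u w : brle u w -> u != w -> len u < len w.
Proof. by move=> h ne; rewrite (ltn_leqif (brle_len h)). Qed.

Lemma brle_eq u w : brle u w -> len w <= len u -> u = w.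
Proof. by move=> h l; apply/eqP; rewrite -(geq_leqif (brle_len h)). Qed.

(** Remove a descent [i] of the top. Either the shortened top is still above [u] and is the coatom
    sought, or a coatom of the shortened interval lifts by [gen i]. *)
Lemma bruhat_chain u w : brle u w -> u != w ->
  exists z, [/\ brle u z, brle z w & len w = (len z).+1].
Proof.
elim/desc_ind: w u => [|i w d IH] u h ne.
  by case/eqP: ne; apply: brle_anti h (brle1 _).
have dw : desc i (gen i * w) by rewrite descN.
have [du|du] := boolP (desc i u); last first.
  have [h1 _] := lift_asc h du dw; rewrite gen_mulK in h1.
  by exists w; rewrite h1 brle_gen // len_asc.
have := lift_desc h du dw; rewrite gen_mulK => h1.
have dgu : ~~ desc i (gen i * u) by rewrite descN du.
have ne' : gen i * u != w by apply: contra ne => /eqP <-; rewrite gen_mulK.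
have [z [uz zw lz]] := IH _ h1 ne'.
have [dz|dz] := boolP (desc i z).
  have [_] := lift_asc uz dgu dz; rewrite gen_mulK => uz'.
  exists w; rewrite brle_gen // len_asc //; split=> //; exact: brle_trans uz' zw.
exists (gen i * z); rewrite !len_asc // lz (lift_gen zw) //; split=> //.
by rewrite -(gen_mulK i u) lift_gen // descN du.
Qed.

(** The atoms of the interval; in rank 2 they are its whole interior. *)
Definition between u w z := [&& brle u z, brle z w & len z == (len u).+1].

(** Remove a descent [i] of the top. An atom without descent [i] can only be the shortened top; the
    others are obtained from [u], or from the interval between [gen i * u] and the shortened top, by
    applying [gen i]. *)
Lemma bruhat_thin u w : brle u w -> len w = (len u).+2 ->
  exists y1 y2, y1 != y2 /\ between u w =1 pred2 y1 y2.
Proof.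
elim/desc_ind: w u => [|i w d IH] u h lw; first by rewrite len1 in lw.
have dw : desc i (gen i * w) by rewrite descN.
rewrite len_asc // in lw; case: lw => lw.
have Ew z : brle u z -> brle z (gen i * w) -> len z = (len u).+1 -> ~~ desc i z -> z = w.
  move=> _ zw lz dz; apply: brle_eq; last by lia.
  by have [] := lift_asc zw dz dw; rewrite gen_mulK.
have [du|du] := boolP (desc i u); last first.
  have [h1 h2] := lift_asc h du dw; rewrite gen_mulK in h1.
  exists w, (gen i * u); split.
    by apply: contraL d => /eqP ->; rewrite descN du.
  move=> z; apply/and3P/orP => [[uz zw /eqP lz]|].
    have [dz|dz] := boolP (desc i z); last by left; rewrite (Ew z).
    right; rewrite eq_sym; apply/eqP/brle_eq; last by rewrite len_asc // lz.
    by have [] := lift_asc uz du dz.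
  case=> /eqP ->; first by rewrite h1 brle_gen // lw.
  by rewrite h2 brle_gen // len_asc.
have lu := len_desc du; have := lift_desc h du dw; rewrite gen_mulK => h1.
have dgu : ~~ desc i (gen i * u) by rewrite descN du.
have [|y1 [y2 [ne E]]] := IH _ h1; first by rewrite lw lu.
(* Among the atoms of the lower interval only [u] can have descent [i], so every other one lifts. *)
have Eu z : between (gen i * u) w z -> desc i z -> z = u.
  case/and3P => uz zw /eqP lz dz; apply/esym/brle_eq; last by rewrite lz lu.
  by have [_] := lift_asc uz dgu dz; rewrite gen_mulK.
have Ed z : desc i z -> between u (gen i * w) z = between (gen i * u) w (gen i * z).
  move=> dz; have lz := len_desc dz.
  apply/and3P/and3P => -[uz zw /eqP l].
    split; [exact: lift_desc|by have := lift_desc zw dz dw; rewrite gen_mulK|by lia].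
  split; last by lia.
    by rewrite -(gen_mulK i u) -(gen_mulK i z) lift_gen // descN dz.
  by rewrite -(gen_mulK i z) lift_gen // descN dz.
(* If [u] is below [w], then [u] is one of the two elements found below [w]. *)
have [uw|uw] := boolP (brle u w); last first.
  have nd y : between (gen i * u) w y -> ~~ desc i y.
    by move=> b; apply: contra uw => dy; rewrite -(Eu _ b dy); case/and3P: b.
  have n1 : ~~ desc i y1 by apply: nd; rewrite E /= eqxx.
  have n2 : ~~ desc i y2 by apply: nd; rewrite E /= eqxx orbT.
  exists (gen i * y1), (gen i * y2); split.
    by rewrite (inj_eq (mulgI _)).
  move=> z; have [dz|dz] := boolP (desc i z).
    by rewrite Ed // E /= -!(inj_eq (mulgI (gen i)) z) !gen_mulK.
  transitivity false.
    apply/and3P => -[uz zw /eqP lz]; case/negP: uw.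
    by rewrite -(Ew z).
  by apply/esym/negbTE; apply: contra dz => /orP [] /eqP ->; rewrite descN.
have bu : between (gen i * u) w u by rewrite /between uw brle_desc // lu eqxx.
have [y [ny Ey]] : exists y, y != u /\ between (gen i * u) w =1 pred2 u y.
  move: bu; rewrite E => /orP [] /eqP eu; rewrite {1 3}eu.
    by exists y2; rewrite eq_sym.
  by exists y1; split=> // z; rewrite E /= orbC.
have dy : ~~ desc i y.
  by apply: contra ny => dy; apply/eqP/Eu => //; rewrite Ey /= eqxx orbT.
exists w, (gen i * y); split.
  by apply: contraL d => /eqP ->; rewrite descN dy.
move=> z; have [dz|dz] := boolP (desc i z).
  rewrite Ed // Ey /= -!(inj_eq (mulgI (gen i)) z) !gen_mulK.
  congr (_ || _); transitivity false.
    by apply/negbTE; apply: contraL dz => /eqP e; rewrite -(gen_mulK i z) e descN du.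
  by apply/esym/negbTE; apply: contraL dz => /eqP /mulgI ->.
apply/idP/orP => [/and3P [uz zw /eqP lz]|[] /eqP ez]; first by left; rewrite (Ew z).
  by rewrite /between ez uw brle_gen //= lw.
by move: dz; rewrite ez descN dy.
Qed.

End BruhatOrder.

(** * Supports and boolean intervals *)

Section Support.
Variable n : nat.
Implicit Types (u v w x : 'S_n) (i j k t : 'I_n.-1) (s : seq 'I_n.-1).

(* [i] is outside the support iff [u] preserves [{0, ..., i}]. *)
Definition supp u := [set i : 'I_n.-1 | 0 < rk u i.+1 i.+1].

Lemma supp_brle u w : brle u w -> supp u \subset supp w.
Proof.
move=> /brleP h; apply/subsetP => i; rewrite !inE => /leq_trans; apply; exact: h.
Qed.

Lemma supp1 : supp 1 = set0.
Proof.
by apply/setP => i; rewrite !inE /rk big1 // => a; rewrite perm1; lia.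
Qed.

Lemma supp_asc i u : ~~ desc i u -> supp (gen i * u) = i |: supp u.
Proof.
move=> d; apply/setP => j; rewrite !inE; have [->|ne] := eqVneq j i; last first.
  by rewrite rk_gen // eqSS.
rewrite rk_desc ?descN // !rk_gen; try lia.
(* Comparison with [1] shows that one of the first [i+2] positions carries a value at least
   [i+1]. *)
have /brleP/(_ i.+2 i.+1) := brle1 u; have := rkS 1 (hi i) i.+1.
by rewrite perm1 /= leqnn => ->; lia.
Qed.

(** Since [supp] is computed from the permutation alone, all reduced words of a permutation have the
    same letters. *)
Lemma supp_word s : reducedb s -> supp (word_prod s) = [set i in s].
Proof.
elim: s => [_|i s IH /= /andP [rs d]].
  by rewrite word_prod_nil supp1; apply/setP => j; rewrite !inE.
by rewrite word_prod_cons supp_asc // IH //; apply/setP => j; rewrite !inE.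
Qed.

Lemma desc_supp i u : desc i u -> i \in supp u.
Proof. by move=> d; rewrite -(gen_mulK i u) supp_asc ?descN ?d // setU11. Qed.

(** Descents lie in the support, so a letter absent from the rest of the word is an ascent. *)
Lemma uniq_reducedb s : uniq s -> reducedb s.
Proof.
elim: s => //= i s IH /andP [si us]; rewrite IH //=; apply: contra si => /desc_supp.
by rewrite supp_word ?IH // inE.
Qed.

Lemma gen_word i : word_prod [:: i] = gen i.
Proof. by rewrite word_prod_cons word_prod_nil mulg1. Qed.

Lemma len_gen i : len (gen i) = 1%N.
Proof. by rewrite -gen_word -reducedb_size // uniq_reducedb. Qed.

Lemma supp_gen i : supp (gen i) = [set i].
Proof. by rewrite -gen_word supp_word ?uniq_reducedb //; apply/setP => j; rewrite !inE. Qed.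

Lemma brle_genE i u : brle (gen i) u = (i \in supp u).
Proof.
apply/idP/idP => [/supp_brle/subsetP|]; first by apply; rewrite supp_gen inE.
have [s rs <-] := exists_reducedb u; rewrite supp_word // inE -gen_word => si.
by apply: brle_subseq; rewrite ?sub1seq //; apply: uniq_reducedb.
Qed.

Lemma in_supportP w x : in_support w x <-> exists2 i, i \in supp w & x = gen i.
Proof.
split=> [[s [i [/reduced_decompositionP [rs <-] si ->]]]|[i iw ->]].
  by exists i; rewrite // supp_word // inE.
have [s rs E] := exists_reducedb w; exists s, i; split=> //.
  exact/reduced_decompositionP.
by move: iw; rewrite -E supp_word // inE.
Qed.

Lemma distinct_len w : len w <= #|supp w| -> distinct_generators_product w.
Proof.
have [s rs <-] := exists_reducedb w; rewrite -reducedb_size // supp_word // => h.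
exists s; split=> //; apply/card_uniqP/eqP; rewrite eqn_leq card_size.
by rewrite (leq_trans h) // cardsE.
Qed.

(** Without repetitions a subword is determined by its letters, so [u] is determined by its
    support. *)
Lemma subword_uniq s u : uniq s -> brle u (word_prod s) ->
  word_prod [seq i <- s | i \in supp u] = u.
Proof.
move=> us h; have [t [rt Et st]] := subword (uniq_reducedb us) erefl h.
rewrite -{2}Et; congr word_prod; rewrite (subseq_uniqP us st).
by apply: eq_filter => i; rewrite -Et supp_word // inE.
Qed.

End Support.

(** * Boolean intervals in the Bruhat order *)

Section BooleanIntervals.
Variable n : nat.
Implicit Types (u v w x z : 'S_n) (i j k t : 'I_n.-1) (s : seq 'I_n.-1).

Lemma intervalP x w u : interval x w u <-> brle x u /\ brle u w.
Proof. by split=> -[/bruhatP ? /bruhatP ?]; split=> //; apply/bruhatP. Qed.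

(** Send [u] to the part of its support outside [supp x]; by [subword_uniq] the order below [w] is
    inclusion of supports. *)
Lemma uniq_boolean s x : uniq s -> brle x (word_prod s) ->
  is_boolean (interval x (word_prod s)) (@bruhat n).
Proof.
move=> us xw; set w := word_prod s in xw *.
pose X : finType := {i : 'I_n.-1 | i \in supp w :\: supp x}.
pose f u : {set X} := [set q : X | val q \in supp u].
have le u v : brle x u -> brle u w -> brle x v -> brle v w ->
    brle u v = (f u \subset f v).
  move=> xu uw xv vw; apply/idP/idP => [/supp_brle/subsetP h|/subsetP h].
    by apply/subsetP => q; move: (h (val q)); rewrite !inE.
  have sub : supp u \subset supp v.
    apply/subsetP => i iu; have [ix|ix] := boolP (i \in supp x).
      by apply: (subsetP (supp_brle xv)).
    have iX : i \in supp w :\: supp x by rewrite inE ix (subsetP (supp_brle uw)).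
    by move: (h (Sub i iX)); rewrite !inE; apply; move: iu; rewrite inE.
  rewrite -(subword_uniq us uw) -(subword_uniq us vw).
  apply: brle_subseq; rewrite ?uniq_reducedb ?filter_uniq //.
  have -> : [seq i <- s | i \in supp u] =
            [seq i <- [seq i <- s | i \in supp v] | i \in supp u].
    rewrite -filter_predI; apply: eq_filter => i /=.
    by apply/idP/andP => [h'|[]//]; rewrite h' (subsetP sub).
  exact: filter_subseq.
exists X, f; split.
- move=> u v /intervalP [xu uw] /intervalP [xv vw] E.
  by apply: brle_anti; rewrite le // E.
(* The preimage of [B] keeps the letters of [s] that lie in [supp x] or in [B]. *)
- move=> B; pose C := supp x :|: [set val q | q in B].
  pose t := [seq i <- s | i \in C]; have ut : uniq t by rewrite filter_uniq.
  have tw : brle (word_prod t) w.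
    by apply: brle_subseq; rewrite ?uniq_reducedb ?filter_subseq.
  have xt : brle x (word_prod t).
    rewrite -(subword_uniq us xw); apply: brle_subseq; rewrite ?uniq_reducedb ?filter_uniq //.
    have -> : [seq i <- s | i \in supp x] = [seq i <- t | i \in supp x].
      rewrite -filter_predI; apply: eq_filter => i /=.
      by apply/idP/andP => [h'|[]//]; rewrite h' inE h'.
    exact: filter_subseq.
  exists (word_prod t); split; first exact/intervalP.
  have sw i : i \in supp w -> i \in s by rewrite supp_word ?uniq_reducedb // inE.
  have st : supp (word_prod t) = [set i in t] by rewrite supp_word ?uniq_reducedb.
  apply/setP => q; have /setDP [qs qx] := valP q; rewrite inE st inE mem_filter.
  by rewrite (sw _ qs) andbT inE (negbTE qx) mem_imset //; exact: val_inj.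
move=> u v /intervalP [xu uw] /intervalP [xv vw].
by rewrite -le //; apply: bruhatP.
Qed.

(** [f] records which of the two atoms lie below [u]. This serves the braid element, whose intervals
    above generators have rank 2. *)
Lemma thin_boolean x w : brle x w -> len w = (len x).+2 ->
  is_boolean (interval x w) (@bruhat n).
Proof.
move=> xw lw; have [y1 [y2 [ne T]]] := bruhat_thin xw lw.
have /and3P [x1 w1 /eqP l1] : between x w y1 by rewrite T /= eqxx.
have /and3P [x2 w2 /eqP l2] : between x w y2 by rewrite T /= eqxx orbT.
pose y b := if b then y1 else y2.
have ly b : len (y b) = (len x).+1 by case: b.
pose f u : {set bool} := [set b | brle (y b) u].
have fx : f x = set0.
  apply/setP => b; rewrite !inE; apply/negbTE/negP => /brle_len [].
  by rewrite ly; lia.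
have fw : f w = setT by apply/setP => -[]; rewrite !inE /y ?w1 ?w2.
have fy b : f (y b) = [set b].
  apply/setP => c; rewrite !inE; apply/idP/eqP => [h|->]; last exact: brle_refl.
  have := brle_eq h; rewrite !ly leqnn => /(_ erefl).
  by case: b c {h} => -[] // /eqP; rewrite /y ?[y2 == _]eq_sym (negbTE ne).
have cases u : interval x w u -> [\/ u = x, u = w | exists b, u = y b].
  case/intervalP => xu uw.
  have [->|xu'] := eqVneq x u; first by constructor 1.
  have [->|uw'] := eqVneq u w; first by constructor 2.
  constructor 3; have h := brlt_len xu xu'; have h' := brlt_len uw uw'.
  have : between x w u by rewrite /between xu uw; lia.
  by rewrite T => /orP [] /eqP ->; [exists true|exists false].
have yw b : brle (y b) w by case: b.
have xy b : brle x (y b) by case: b.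
have le u v : interval x w u -> interval x w v -> brle u v = (f u \subset f v).
  move=> iu iv; apply/idP/idP => [h|].
    by apply/subsetP => b; rewrite !inE => /brle_trans; apply.
  have [xv vw] := (intervalP _ _ _).1 iv.
  have [-> //|->|[b ->]] := cases u iu.
    rewrite fw => /subsetP h; have [E|E|[c E]] := cases v iv.
    - by have := h true; rewrite E fx !inE; move/(_ erefl).
    - by rewrite E brle_refl.
    by have := h (~~ c); rewrite E fy !inE; move/(_ erefl); case: c {E}.
  by rewrite fy sub1set inE.
exists bool, f; split.
- by move=> u v iu iv E; apply: brle_anti; rewrite le // E.
- move=> B; have [t|t] := boolP (true \in B); have [fa|fa] := boolP (false \in B).
  + exists w; split; first by apply/intervalP; rewrite brle_refl.
    by rewrite fw; apply/setP => -[]; rewrite inE ?t ?fa.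
  + exists (y true); split; first by apply/intervalP.
    by rewrite fy; apply/setP => -[]; rewrite inE ?t ?(negbTE fa).
  + exists (y false); split; first by apply/intervalP.
    by rewrite fy; apply/setP => -[]; rewrite inE ?(negbTE t) ?fa.
  exists x; split; first by apply/intervalP; rewrite brle_refl.
  by rewrite fx; apply/setP => -[]; rewrite inE ?(negbTE t) ?(negbTE fa).
by move=> u v iu iv; rewrite -le //; apply: bruhatP.
Qed.

(** The isomorphism turns length above [x] into cardinality, so the atoms are the preimages of the
    singletons. *)
Lemma boolean_card_atoms x w : brle x w ->
  is_boolean (interval x w) (@bruhat n) ->
  #|[set u | between x w u]| + len x = len w.
Proof.
move=> xw [X [f [finj fsur fle]]].
have le u v : interval x w u -> interval x w v -> brle u v = (f u \subset f v).
  move=> iu iv; apply/idP/idP => [/bruhatP/(fle _ _ iu iv)//|h].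
  exact/bruhatP/(fle _ _ iu iv).
have ix : interval x w x by apply/intervalP; rewrite brle_refl.
have iw : interval x w w by apply/intervalP; rewrite brle_refl.
have fx : f x = set0.
  have [u [iu Eu]] := fsur set0; apply/eqP; rewrite -subset0 -Eu -le //.
  by case/intervalP: iu.
have fw : f w = setT.
  have [u [iu Eu]] := fsur setT; apply/eqP; rewrite -subTset -Eu -le //.
  by case/intervalP: iu.
have cardf u : interval x w u -> #|f u| + len x = len u.
  have [m] := ubnP (len u); elim: m u => // m IH u lm iu.
  have [xu uw] := (intervalP _ _ _).1 iu.
  have [<-|ne] := eqVneq x u; first by rewrite fx cards0.
  have [z [xz zu lu]] := bruhat_chain xu ne.
  have iz : interval x w z by apply/intervalP; split=> //; apply: brle_trans zu uw.
  rewrite lu -(IH z) //; last by lia.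
  suff -> : #|f u| = #|f z|.+1 by [].
  have sub : f z \subset f u by rewrite -le.
  have [|y yu yz] := subsetPn (_ : ~~ (f u \subset f z)).
    rewrite -le //; apply/negP => uz.
    by have := brle_len uz; rewrite lu => -[]; lia.
  (* Adding to [f z] one element of [f u] gives an element strictly above [z] and below [u]; since
     [u] is only one longer than [z], it is [u]. *)
  have [c [ic Ec]] := fsur (y |: f z).
  have zc : brle z c by rewrite le // Ec subsetUr.
  have cu : brle c u by rewrite le // Ec subUset sub1set yu.
  have zc' : z != c by apply: contra yz => /eqP ->; rewrite Ec setU11.
  have -> : u = c.
    by apply/esym/(brle_eq cu); rewrite lu; exact: brlt_len zc zc'.
  by rewrite Ec cardsU1 yz.
rewrite -(cardf _ iw) fw; congr (_ + _).
have atomE u : interval x w u -> between x w u = (#|f u| == 1%N).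
  move=> iu; have [xu uw] := (intervalP _ _ _).1 iu.
  by rewrite /between xu uw /= -(cardf u iu) -[(len x).+1]add1n eqn_add2r.
have bI u : between x w u -> interval x w u.
  by case/and3P => xu uw _; apply/intervalP.
have inj : {in [set u | between x w u] &, injective f}.
  by move=> u v; rewrite !inE => /bI iu /bI iv; apply: finj.
rewrite cardsT -(card_in_imset inj) -(card_imset _ (@set1_inj X)).
apply: eq_card => B; apply/imsetP/imsetP => -[y].
  rewrite inE => bu ->; move: (bu); rewrite atomE; last exact: bI.
  by case/cards1P => b ->; exists b.
move=> _ ->; have [u [iu Eu]] := fsur [set y]; exists u => //.
by rewrite inE atomE // Eu cards1.
Qed.

Lemma modular_boolean x w : brle x w ->
  is_modular_lattice (interval x w) (@bruhat n) ->
  is_boolean (interval x w) (@bruhat n).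
Proof.
move=> xw [d [L [[f [finj fsur fle]] modular]]].
(* [g] is the inverse of [f]; surjectivity makes [pick] succeed. *)
pose g (c : L) : 'S_n := odflt x [pick u | [&& brle x u, brle u w & f u == c]].
have gP c : interval x w (g c) /\ f (g c) = c.
  rewrite /g; case: pickP => [u /and3P [xu uw /eqP <-]|no] /=.
    by split=> //; apply/intervalP.
  have [u [/intervalP [xu uw] E]] := fsur c.
  by have := no u; rewrite xu uw E eqxx.
have gI c := (gP c).1; have fg c := (gP c).2.
have xg c : brle x (g c) by have /intervalP [] := gI c.
have gw c : brle (g c) w by have /intervalP [] := gI c.
have gf u : interval x w u -> g (f u) = u by move=> iu; apply: finj.
have le a b : (a <= b)%O = brle (g a) (g b).
  rewrite -{1}(fg a) -{1}(fg b); apply/idP/idP => [/fle/bruhatP|h]; first exact.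
  by apply/fle => //; apply/bruhatP.
have ginj : injective g by move=> a b E; rewrite -(fg a) E fg.
have lt a b : (a < b)%O = (g a != g b) && brle (g a) (g b).
  by rewrite Order.POrderTheory.lt_neqAle le (inj_eq ginj).
pose rank c := len (g c); pose o := f x.
have ix : interval x w x by apply/intervalP; rewrite brle_refl.
have go : g o = x by rewrite gf.
have le_o a : (o <= a)%O by rewrite le go.
have lt_rank a b : (a < b)%O -> rank a < rank b.
  by rewrite lt => /andP [ne h]; apply: brlt_len.
have chain a b : (a < b)%O -> exists c, [/\ (a <= c)%O, (c < b)%O & rank b = (rank c).+1].
  rewrite lt => /andP [ne h]; have [z [az zb r]] := bruhat_chain h ne.
  have iz : interval x w z.
    by apply/intervalP; rewrite (brle_trans (xg a)) // (brle_trans zb).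
  exists (f z); rewrite /rank le lt gf //; split=> //; rewrite zb andbT.
  by apply/eqP => E; move: r; rewrite E; lia.
have thin a b : (a < b)%O -> rank b = (rank a).+2 ->
    exists y1 y2, y1 != y2 /\ forall c, (a < c < b)%O = (c == y1) || (c == y2).
  rewrite lt => /andP [_ h] r; have [y1 [y2 [ne T]]] := bruhat_thin h r.
  have inI y : between (g a) (g b) y -> interval x w y.
    by case/and3P => ay yb _; apply/intervalP; rewrite (brle_trans (xg a)) // (brle_trans yb).
  have i1 : interval x w y1 by apply: inI; rewrite T /= eqxx.
  have i2 : interval x w y2 by apply: inI; rewrite T /= eqxx orbT.
  exists (f y1), (f y2); split.
    by apply: contra ne => /eqP /finj -> //.
  move=> c; rewrite -!(inj_eq ginj) !gf //; have /= <- := T (g c).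
  rewrite !lt /between; apply/idP/idP.
    case/andP => /andP [n1 h1] /andP [n2 h2]; rewrite h1 h2 /=.
    by have := brlt_len h1 n1; have := brlt_len h2 n2; move: r; rewrite /rank; lia.
  case/and3P => h1 h2 /eqP l; rewrite h1 h2 !andbT; apply/andP; split.
    by apply/eqP => E; move: l; rewrite E; lia.
  by apply/eqP => E; move: l r; rewrite /rank E; lia.
have atomicP := atomistic le_o lt_rank chain thin.
have joinP := join_atoms le_o lt_rank chain thin modular.
pose X : finType := {u : 'S_n | between x w u}.
(* Each element is coded by the atoms below it: [atomicP] shows that the code determines the order,
   and [joinP] that the join of a set [B] of atoms has code [B]. *)
pose F u : {set X} := [set q : X | brle (val q) u].
have atomE u : interval x w u -> between x w u = atom rank o (f u).
  move=> iu; have [xu uw] := (intervalP _ _ _).1 iu.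
  by rewrite /between xu uw /atom /rank gf // go.
have iX (q : X) : interval x w (val q).
  by have /and3P [xu uw _] := valP q; apply/intervalP.
have leF u v : interval x w u -> interval x w v -> brle u v = (F u \subset F v).
  move=> iu iv; apply/idP/subsetP => [h q|h].
    by rewrite !inE => /brle_trans; apply.
  rewrite -(gf u iu) -(gf v iv) -le; apply: atomicP => p pa.
  have pX : between x w (g p) by rewrite atomE ?fg.
  by have := h (Sub (g p) pX); rewrite !inE /= !le !gf.
exists X, F; split.
- by move=> u v iu iv E; apply: brle_anti; rewrite leF // E.
- move=> B; pose s := [seq f (val q) | q <- enum B].
  have sa : all (atom rank o) s.
    by apply/allP => _ /mapP [q _ ->]; rewrite -(atomE _ (iX q)); exact: (valP q).
  exists (g (foldr Order.join o s)); split=> //.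
  apply/setP => q; rewrite inE -{1}(gf _ (iX q)) -le joinP //; last first.
    by rewrite -(atomE _ (iX q)); exact: (valP q).
  apply/mapP/idP => [[q']|qB]; last by exists q; rewrite ?mem_enum.
  by rewrite mem_enum => q'B /finj E; rewrite (val_inj (E (iX q) (iX q'))).
by move=> u v iu iv; rewrite -leF //; apply: bruhatP.
Qed.

End BooleanIntervals.

(** * Boolean, distributive and modular lattices *)

Section BooleanLattices.
Import Order.DefaultSetSubsetOrder Order.Theory.
Variables (T : Type) (A : T -> Prop) (leT : T -> T -> Prop).

Lemma boolean_distributive : is_boolean A leT -> is_distributive_lattice A leT.
Proof.
case=> X [f h]; exists _, ({set X} : distrLatticeType _), f.
by move: h => [? ? ?]; split.
Qed.

Lemma distributive_modular : is_distributive_lattice A leT -> is_modular_lattice A leT.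
Proof.
case=> d [L h]; exists d, L; split=> // a b c ac.
by rewrite joinIr (join_r ac).
Qed.

End BooleanLattices.

Lemma is_boolean_ext (T : Type) (A B : T -> Prop) (leT : T -> T -> Prop) :
  (forall x, A x <-> B x) -> is_boolean A leT -> is_boolean B leT.
Proof.
move=> AB [X [f [fi fs fl]]]; exists X, f; split.
- by move=> x y /AB Ax /AB Ay; apply: fi.
- by move=> z; have [x [/AB Bx fx]] := fs z; exists x.
by move=> x y /AB Ax /AB Ay; apply: fl.
Qed.

(** * Elements of length two *)

Section SupportIntervals.
Variable n : nat.
Implicit Types (u v w x z : 'S_n) (i j k t : 'I_n.-1) (s : seq 'I_n.-1).

Lemma gen2_word i j : word_prod [:: i; j] = gen i * gen j.
Proof. by rewrite word_prod_cons gen_word. Qed.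

Lemma reduced2 i j : i != j -> reducedb [:: i; j].
Proof. by move=> ne; rewrite uniq_reducedb //= inE ne. Qed.

Lemma supp_gen2 i j : i != j -> supp (gen i * gen j) = [set i; j].
Proof.
move=> ne; rewrite -gen2_word supp_word ?reduced2 //.
by apply/setP => k; rewrite !inE.
Qed.

Lemma len_gen2 i j : i != j -> len (gen i * gen j) = 2.
Proof. by move=> ne; rewrite -gen2_word -reducedb_size ?reduced2. Qed.

Lemma gen2_adjacent i j : gen i * gen j != gen j * gen i ->
  i.+1 = j :> nat \/ j.+1 = i :> nat.
Proof.
case: (ltngtP i.+1 j) => [h|h|->]; last by left.
  by rewrite gen_comm ?h ?eqxx.
case: (ltngtP j.+1 i) => [h'|h'|->]; last by right.
  by rewrite gen_comm ?h' ?orbT ?eqxx.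
have -> : i = j by apply: val_inj => /=; lia.
by rewrite eqxx.
Qed.

(** An atom above [gen i] has length 2, so its reduced words consist of [i] and one other letter. *)
Lemma between_genE i w u : between (gen i) w u =
  [exists t, [&& t != i, brle u w & (u == gen i * gen t) || (u == gen t * gen i)]].
Proof.
rewrite /between brle_genE len_gen; apply/and3P/existsP => [[iu uw /eqP l]|[t]].
  have [s rs E] := exists_reducedb u; move: l iu uw; rewrite -E supp_word // inE.
  rewrite -reducedb_size // => ls; move: rs E.
  case: s ls => [|a [|b []]] // _ rs E; rewrite !inE gen2_word => ia ->.
  have ab : a != b.
    by apply: contraTneq rs => ->;
      rewrite /= gen_word [desc b (gen b)]/desc gen_lo gen_hi ltnSn andbF.
  case/orP: ia => /eqP ->; [exists b|exists a]; rewrite eqxx ?orbT //.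
    by rewrite eq_sym ab.
  by rewrite ab.
case/and3P => ne -> /orP [] /eqP ->.
  by rewrite len_gen2 1?eq_sym // supp_gen2 1?eq_sym // !inE eqxx.
by rewrite len_gen2 // supp_gen2 // !inE eqxx orbT.
Qed.

(** The product of two non-commuting generators has a single reduced word, so the subword found in
    [s] cannot have its letters in the other order. *)
Lemma subseq_gen2 s i j : reducedb s -> brle (gen i * gen j) (word_prod s) ->
  gen i * gen j != gen j * gen i -> subseq [:: i; j] s.
Proof.
move=> rs h nc; have ne : i != j by apply: contraNneq nc => ->.
have [t [rt Et st]] := subword rs erefl h.
have := reducedb_size rt; rewrite Et len_gen2 // => lt.
have := supp_word rt; rewrite Et supp_gen2 // => S.
case: t lt rt Et st S => [|a [|b []]] // _ _ E st S.
have Sx k : (k == i) || (k == j) = (k == a) || (k == b).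
  by rewrite -in_set2 S !inE.
have ha := Sx a; have hb := Sx b; have hi := Sx i; have hj := Sx j.
move: ha hb hi hj; rewrite !eqxx ?orbT /= => ha hb hi hj.
case/orP: ha => /eqP ea; case/orP: hb => /eqP eb; subst a b.
- by move: hj; rewrite orbb eq_sym (negbTE ne).
- by [].
- by move: nc; rewrite -E gen2_word eqxx.
by move: hi; rewrite orbb (negbTE ne).
Qed.

End SupportIntervals.

(** * Permutations with boolean intervals above all generators of the support *)

Section AllBoolean.
Variables (n : nat) (w : 'S_n).
Implicit Types (u x : 'S_n) (i j k t : 'I_n.-1) (s : seq 'I_n.-1).

(** What [boolean_card_atoms] extracts from booleanness: as many atoms as the rank, which is
    [len w - 1]. *)
Hypothesis card_atoms :
  forall i, i \in supp w -> (#|[set u | between (gen i) w u]|).+1 = len w.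

(** The letter [t] contributes two distinct atoms above [gen i], and [i] two above [gen t]. *)
Definition both i t := [&& brle (gen i * gen t) w, brle (gen t * gen i) w
  & gen i * gen t != gen t * gen i].

Lemma brle_gen2_supp i t : i != t ->
  brle (gen i * gen t) w -> i \in supp w /\ t \in supp w.
Proof.
by move=> ne /supp_brle; rewrite supp_gen2 // subUset !sub1set => /andP [].
Qed.

Lemma len_all_boolean : len w <= (#|supp w|).+1.
Proof.
have [E|/set0Pn [i0 hi0]] := eqVneq (supp w) set0.
  by rewrite leqNgt E cards0; apply/negP; move: E; have [s rs <-] := exists_reducedb w;
    rewrite supp_word // -reducedb_size //; case: s rs => // a s _ /setP /(_ a); rewrite !inE eqxx.
pose m := [arg min_(i < i0 in supp w) (i : nat)].
have [mw mmin] : m \in supp w /\ forall i, i \in supp w -> m <= i.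
  by rewrite /m; case: arg_minnP.
rewrite -(card_atoms mw) ltnS.
(* [M] has one product for each further letter [t]; the reversed product is new only if [t = m + 1],
   because [m] is minimal and distant generators commute. *)
pose N := [set gen t * gen m | t in [set t in supp w | t == m.+1 :> nat]].
pose M := [set gen m * gen t | t in supp w :\ m].
have sub : [set u | between (gen m) w u] \subset M :|: N.
  apply/subsetP => u; rewrite inE between_genE => /existsP [t /and3P [tm uw h]].
  have tw : t \in supp w.
    by case/orP: h => /eqP E; move: uw; rewrite E => /brle_gen2_supp [] //; rewrite eq_sym.
  have inM : gen m * gen t \in M by apply: imset_f; rewrite !inE tm; move: tw; rewrite inE.
  rewrite inE; case/orP: h => /eqP ->; first by rewrite inM.
  have [tm1|tm1] := eqVneq (t : nat) m.+1.
    by apply/orP; right; apply: imset_f; rewrite inE tw tm1 /=.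
  rewrite -gen_comm ?inM //; have := mmin t tw; move: tm tm1; rewrite -val_eqE /=; lia.
have cM : #|M| <= #|supp w|.-1.
  by rewrite (leq_trans (leq_imset_card _ _)) // (cardsD1 m (supp w)) mw.
have cN : #|N| <= 1.
  rewrite (leq_trans (leq_imset_card _ _)) //; apply/card_le1_eqP => a b.
  by rewrite !inE => /andP [_ /eqP ea] /andP [_ /eqP eb]; apply: val_inj; rewrite /= ea eb.
have cw : 0 < #|supp w| by apply/card_gt0P; exists m.
have := subset_leq_card sub; have := (leq_card_setU M N).1; lia.
Qed.

(** If no letter contributed two atoms, [phi] would map [supp w] minus [i] onto a set containing all
    atoms, giving [len w <= #|supp w|]. *)
Lemma exists_both i : #|supp w| < len w -> i \in supp w -> exists t, both i t.
Proof.
move=> lw iw; apply/existsP; apply: contraLR lw; rewrite negb_exists -leqNgt => /forallP no.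
rewrite -(card_atoms iw) (cardsD1 i (supp w)) iw add1n ltnS.
pose phi t := if brle (gen i * gen t) w then gen i * gen t else gen t * gen i.
apply: leq_trans (leq_imset_card phi _); apply: subset_leq_card.
apply/subsetP => u; rewrite inE between_genE => /existsP [t /and3P [ti uw h]].
have tw : t \in supp w.
  by case/orP: h => /eqP E; move: uw; rewrite E => /brle_gen2_supp [] //; rewrite eq_sym.
suff -> : u = phi t by apply: imset_f; rewrite !inE ti; move: tw; rewrite inE.
have := no t; rewrite /both /phi.
case/orP: h => /eqP E; rewrite -?E; first by rewrite uw.
by rewrite uw /=; case: ifP => //= _ /negPn /eqP.
Qed.

Lemma all_boolean_word : #|supp w| < len w ->
  exists i j, w = gen j * gen i * gen j /\ (i.+1 = j :> nat \/ j.+1 = i :> nat).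
Proof.
move=> lw; have lw1 : len w = (#|supp w|).+1 by have := len_all_boolean; lia.
have [s rs E] := exists_reducedb w.
have Ss : supp w = [set i in s] by rewrite -E supp_word.
have ls : size s = (#|supp w|).+1 by rewrite -lw1 -E reducedb_size.
(* The word is longer than its number of letters, so some [a] repeats. *)
have [a ar] : exists a, a \in rem a s.
  apply/existsP; apply: contraT; rewrite negb_exists => /forallP no.
  suff /card_uniqP us : uniq s by move: ls; rewrite Ss cardsE us => /n_Sn.
  apply: count_mem_uniq => x; have [xs|xs] := boolP (x \in s); last exact/count_memPn.
  have /count_memPn := no x; rewrite count_mem_rem eqxx => c0.
  have c1 : 0 < count_mem x s by rewrite -has_count has_pred1.
  by apply/eqP; rewrite eqn_leq c1 -subn_eq0 c0.
have as_ : a \in s := mem_rem ar.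
(* Removing one [a] leaves a word as long as its number of letters, so nothing else repeats. *)
have ur : uniq (rem a s).
  apply/card_uniqP; rewrite size_rem // ls /= Ss cardsE; apply: eq_card => x.
  apply/idP/idP => [/mem_rem //|xs]; have [->//|xa] := eqVneq x a.
  by move: xs; rewrite (perm_mem (perm_to_rem as_)) inE (negbTE xa).
have ua : uniq [seq k <- s | k != a].
  by rewrite (perm_uniq (perm_filter _ (perm_to_rem as_))) /= eqxx filter_uniq.
have partner i : i \in supp w -> i != a -> both i a.
  move=> iw ia; have [t bt] := exists_both lw iw; have [<-//|ta] := eqVneq t a.
  case/and3P: bt => b1 b2 nc.
  have s1 : subseq [:: i; t] s by apply: subseq_gen2; rewrite ?E.
  have s2 : subseq [:: t; i] s by apply: subseq_gen2; rewrite ?E // eq_sym.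
  (* Letters other than [a] occur once, so [s] cannot contain [i] before [t] and also [t] before
     [i]. *)
  have key k l : k != a -> l != a -> subseq [:: k; l] s ->
      [:: k; l] = [seq z <- [seq z <- s | z != a] | z \in [:: k; l]].
    move=> ka la skl; apply: subseq_uniqP => //.
    by rewrite subseq_filter skl /= ka la.
  have := key _ _ ia ta s1; rewrite (eq_filter (a2 := fun z => z \in [:: t; i])).
    by rewrite -(key _ _ ta ia s2) => -[ti _]; move: nc; rewrite ti eqxx.
  by move=> z; rewrite !inE orbC.
have aw : a \in supp w by rewrite Ss inE.
have [b bab] := exists_both lw aw; case/and3P: (bab) => b1 b2 nc.
have ab : a != b by apply: contraNneq nc => ->.
have bw : b \in supp w by have [] := brle_gen2_supp ab b1.
have adj c : c \in supp w -> c != a -> c.+1 = a :> nat \/ a.+1 = c :> nat.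
  by move=> cw ca; have /and3P [_ _] := partner c cw ca; apply: gen2_adjacent.
have adjb := gen2_adjacent nc.
(* A third letter [c] would be the other neighbour of [a], so the support, and with it the number of
   atoms above [gen a], would be at most 3, while [b] and [c] contribute four atoms. *)
have Sab c : c \in supp w -> (c == a) || (c == b).
  move=> cw; apply: contraT; rewrite negb_or => /andP [ca cb].
  have /and3P [c1 c2 ncc] := partner c cw ca.
  have le3 : #|supp w| <= 3.
    have sub : supp w \subset [set a; b; c].
      apply/subsetP => d dw; rewrite !inE; have [//|da] := eqVneq d a.
      have := adj d dw da; have := adj c cw ca; move: cb adjb; clear.
      by rewrite -!val_eqE /=; lia.
    apply: leq_trans (subset_leq_card sub) _.
    by rewrite (leq_trans (leq_card_setU _ _).1) // cards1 cards2 ab.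
  have := card_atoms aw; rewrite lw1 => -[] Ea.
  have : size [:: gen a * gen b; gen b * gen a; gen a * gen c; gen c * gen a] <= 3.
    apply: leq_trans le3; rewrite -Ea cardE; apply: uniq_leq_size.
      have sb u : u \in [:: gen a * gen b; gen b * gen a] -> c \notin supp u.
        have ba : b != a by rewrite eq_sym.
        by rewrite mem_seq2 => /orP [] /eqP ->; rewrite supp_gen2 // in_set2 !negb_or ca cb.
      have sc u : u \in [:: gen a * gen c; gen c * gen a] -> c \in supp u.
        have ac : a != c by rewrite eq_sym.
        by rewrite mem_seq2 => /orP [] /eqP ->; rewrite supp_gen2 // in_set2 eqxx ?orbT.
      rewrite -[[:: _; _; _; _]]/([:: gen a * gen b; gen b * gen a] ++
                                  [:: gen a * gen c; gen c * gen a]).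
      rewrite cat_uniq; apply/and3P; split.
      - by rewrite /= mem_seq1 nc.
      - by apply/hasPn => u /sc uc; apply/negP => /sb; rewrite uc.
      by rewrite /= mem_seq1 eq_sym ncc.
    move=> u hu; rewrite mem_enum inE between_genE; apply/existsP.
    move: hu; rewrite !inE => /or4P [] /eqP ->; [exists b|exists b|exists c|exists c];
      by rewrite eqxx ?orbT andbT ?b1 ?b2 ?c1 ?c2 andbT // eq_sym.
  by [].
have p2 : #|supp w| = 2.
  rewrite (_ : supp w = [set a; b]) ?cards2 ?ab //; apply/setP => k; rewrite in_set2.
  by apply/idP/orP => [/Sab/orP //|[] /eqP ->].
have memab k : k \in s -> (k == a) || (k == b) by move=> ks; apply: Sab; rewrite Ss inE.
(* [s] has three letters from [{a, b}], and consecutive letters of a reduced word differ, so [s]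
   alternates. *)
rewrite p2 in ls; case: s ls rs E memab {Ss as_ ar ur ua partner} =>
  [|x [|y [|z []]]] // _ rs E memab.
have neq k l r : reducedb [:: k, l & r] -> k != l.
  by move=> /= /andP [/andP [_ d]]; apply: contraNneq => ->; rewrite word_prod_cons descN.
have xy := neq _ _ _ rs; have yz : y != z by case/andP: rs => /neq.
have := memab x; have := memab y; have := memab z; rewrite !inE !eqxx !orbT.
move=> /(_ erefl) hz /(_ erefl) hy /(_ erefl) hx.
have ez : z = x.
  apply/eqP; move: hx hy hz xy yz.
  by do 3![case/orP => /eqP ->]; rewrite ?eqxx.
exists y, x; split; first by rewrite -E ez !word_prod_cons word_prod_nil mulg1 mulgA.
move: hx hy xy adjb.
by case/orP => /eqP ->; case/orP => /eqP ->; rewrite ?eqxx //; tauto.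
Qed.

End AllBoolean.

(** * The braid element and the characterization *)

Lemma len_braid (n : nat) (k k1 : 'I_n.-1) : k1 = k.+1 :> nat ->
  len (gen k1 * gen k * gen k1) = 3.
Proof.
move=> h; have ne : k != k1 by rewrite -val_eqE /=; lia.
have r2 := reduced2 ne.
have -> : gen k1 * gen k * gen k1 = word_prod [:: k1; k; k1].
  by rewrite word_prod_cons gen2_word mulgA.
rewrite -reducedb_size //; rewrite -[reducedb _]/(reducedb [:: k; k1] && ~~ _) r2.
by rewrite gen2_word asc_gen2.
Qed.

Theorem corollary6p3 (n : nat) (w : 'S_n) :
  [/\ forall x : 'S_n, in_support w x ->
        (is_boolean (interval x w) (@bruhat n) <->
           is_modular_lattice (interval x w) (@bruhat n)) /\
        (is_boolean (interval x w) (@bruhat n) <->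
           is_distributive_lattice (interval x w) (@bruhat n)),
      distinct_generators_product w <->
        is_boolean (principal_ideal w) (@bruhat n)
    & (forall x : 'S_n, in_support w x ->
         is_boolean (interval x w) (@bruhat n)) <->
      (distinct_generators_product w \/
       exists k k1 : 'I_n.-1,
         nat_of_ord k1 = (nat_of_ord k).+1 /\ w = gen k1 * gen k * gen k1)].
Proof.
have supp_le x : in_support w x -> brle x w.
  by case/in_supportP => i iw ->; rewrite brle_genE.
split.
- move=> x /supp_le xw.
  have bd := @boolean_distributive _ (interval x w) (@bruhat n).
  have dm := @distributive_modular _ (interval x w) (@bruhat n).
  by have mb := modular_boolean xw; tauto.
- have idealE u : principal_ideal w u <-> interval 1 w u.
    by split=> [h|[]//]; split=> //; apply/bruhatP/brle1.
  split=> [[s [us <-]]|B].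
    apply: is_boolean_ext (uniq_boolean us (brle1 _)) => u.
    by split=> [[]//|h]; split=> //; apply/bruhatP/brle1.
  (* Booleanness gives [len w] atoms above [1], and these are generators of the support. *)
  apply: distinct_len.
  have := boolean_card_atoms (brle1 w) (is_boolean_ext idealE B).
  rewrite len1 addn0 => <-; apply: leq_trans (leq_imset_card (@gen n) _).
  apply/subset_leq_card/subsetP => u; rewrite inE /between len1 => /and3P [_ uw /eqP lu].
  have [s rs Es] := exists_reducedb u; have := reducedb_size rs; rewrite Es lu.
  case: s rs Es => [|i []] // _; rewrite gen_word => Eu _; move: uw.
  by rewrite -Eu brle_genE => iw; apply: imset_f.
split=> [B|[[s [us <-]] x /in_supportP [i iw ->]|[k [k1 [h E]]] x xw]].
- have ca i : i \in supp w -> (#|[set u | between (gen i) w u]|).+1 = len w.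
    move=> iw; have iw' : in_support w (gen i) by apply/in_supportP; exists i.
    by have := boolean_card_atoms (supp_le _ iw') (B _ iw'); rewrite len_gen addn1.
  have [lw|lw] := leqP (len w) #|supp w|; first by left; apply: distinct_len.
  right; have [i [j [E [h|h]]]] := all_boolean_word ca lw; first by exists i, j.
  (* The braid relation exchanges the roles of the two letters. *)
  by exists j, i; rewrite E -gen_braid.
- by apply: uniq_boolean => //; rewrite brle_genE.
(* The top has length 3 and the bottom length 1, so the interval has rank 2. *)
apply: thin_boolean; first exact: supp_le.
by case/in_supportP: xw => i _ ->; rewrite len_gen E len_braid.
Qed.
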